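(* Let $A,B$ be finite-dimensional quantum systems, let $\mathcal{N}:\mathscr{L}_A\to\mathscr{L}_B$ be any quantum channel, and let $\rho$ be any quantum state on $B'\cong B$. Consider the following single-query protocol: prepare the normalized maximally entangled state on $A'A$ (with $A'\cong A$) together with $\rho_{B'}$; apply $\mathcal{N}$ to system $A$, producing system $B$; perform on $B'B$ the two-outcome projective measurement $\{\phi_{B'B},\,\mathbb{1}-\phi_{B'B}\}$, where $\phi_{B'B}$ is the projector onto the maximally entangled state; accept if the outcome is $\phi_{B'B}$. Then the unnormalized state of system $A'$ upon acceptance is $$\frac{1}{d_Ad_B}\,\mathcal{N}^{\mathsf T}(\rho),$$ so that the protocol exactly implements $\mathcal{N}^{\mathsf T}$ probabilistically, with success probability $$p_{\mathrm{suc}}=\frac{\mathrm{Tr}\big[\mathsf{N}_{AB}(\mathbb{1}_A\otimes\rho^{\mathsf T})\big]}{d_Ad_B}.$$ In particular, if $d_A=d_B=d$ and $\mathcal{N}$ is unital, i.e. $\mathcal{N}(\mathbb{1})=\mathbb{1}$, then $p_{\mathrm{suc}}=1/d^2$.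
   Context: A quantum system $A$ is a $d_A$-dimensional complex Hilbert space with a fixed orthonormal basis $\{|i\rangle\}$; $\mathscr{L}_A$ is the space of linear operators on it. A quantum channel is a completely positive trace-preserving linear map. The normalized maximally entangled state on $A'A$ is $\frac{1}{d_A}\sum_{i,j}|ii\rangle\langle jj|_{A'A}$, and $\phi_{B'B}=\frac{1}{d_B}\sum_{i,j}|ii\rangle\langle jj|_{B'B}$. For a channel with Kraus representation $\mathcal{N}(\cdot)=\sum_jK_j(\cdot)K_j^\dagger$, its transpose is the map $\mathcal{N}^{\mathsf T}:\mathscr{L}_B\to\mathscr{L}_A$, $\mathcal{N}^{\mathsf T}(\cdot)=\sum_jK_j^{\mathsf T}(\cdot)K_j^{*}$, with transpose and complex conjugate taken in the fixed bases. $\mathsf{N}_{AB}=\sum_{i,j}|i\rangle\langle j|_A\otimes\mathcal{N}(|i\rangle\langle j|)_B$ is the Choi operator of $\mathcal{N}$. The unnormalized state upon acceptance means the partial trace over $B'B$ of the acceptance projector applied to the pre-measurement state; its trace is the success probability. *)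

(* Defs.v *)
From HB Require Import structures.
From mathcomp Require Import all_boot all_order all_algebra.
From mathcomp Require Import boolp classical_sets.
From mathcomp Require Import mxtens.

Set Implicit Arguments.
Unset Strict Implicit.
Unset Printing Implicit Defensive.

Import Order.TTheory GRing.Theory Num.Theory.
Local Open Scope ring_scope.
Local Open Scope sesquilinear_scope.

(* Operators on the d-dimensional system are matrices 'M[C]_d in the fixed    *)
(* basis. The composite of systems of dimensions m and p, in this order, has  *)
(* operators 'M[C]_(m * p), with |i>|j> the basis vector of index             *)
(* mxtens_index (i, j) and *t the tensor product of operators.                *)

Section Operators.
Variable C : numClosedFieldType.

(* In a numClosedFieldType, 0 <= z means that z is real and nonnegative, so   *)
(* this forces X to be hermitian.                                             *)
Definition psd n (X : 'M[C]_n) : Prop :=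
  forall v : 'cV[C]_n, 0 <= (v ^t* *m X *m v) 0 0.

Definition density n (rho : 'M[C]_n) : Prop := psd rho /\ \tr rho = 1.

(* F (x) G, by expansion of X in the basis |i><j| (x) |k><l|; the intended    *)
(* use is for linear F and G, see tensmap_tens.                               *)
Definition tensmap m n p q (F : 'M[C]_m -> 'M[C]_n) (G : 'M[C]_p -> 'M[C]_q)
    (X : 'M[C]_(m * p)) : 'M[C]_(n * q) :=
  \sum_i \sum_j \sum_k \sum_l
    X (mxtens_index (i, k)) (mxtens_index (j, l)) *:
      (F (delta_mx i j) *t G (delta_mx k l)).

Definition ptrace2 m p (X : 'M[C]_(m * p)) : 'M[C]_m :=
  \matrix_(i, j) \sum_k X (mxtens_index (i, k)) (mxtens_index (j, k)).

(* (1/d) sum_(i,j) |ii><jj|. It is invariant under exchange of the two        *)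
(* subsystems, so their order is immaterial.                                  *)
Definition maxent d : 'M[C]_(d * d) :=
  d%:R^-1 *: \sum_(i < d) \sum_(j < d)
    delta_mx (mxtens_index (i, i)) (mxtens_index (j, j)).

Section Channels.
Variables dA dB : nat.

Definition completely_positive (N : 'M[C]_dA -> 'M[C]_dB) : Prop :=
  forall k (X : 'M[C]_(k * dA)),
    psd X -> psd (tensmap (fun Y : 'M[C]_k => Y) N X).

Definition trace_preserving (N : 'M[C]_dA -> 'M[C]_dB) : Prop :=
  forall X, \tr (N X) = \tr X.

Definition channel (N : {linear 'M[C]_dA -> 'M[C]_dB}) : Prop :=
  completely_positive N /\ trace_preserving N.

Definition kraus_rep (Ks : seq 'M[C]_(dB, dA)) (N : 'M[C]_dA -> 'M[C]_dB) :
    Prop :=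
  forall X, N X = \sum_(K <- Ks) K *m X *m K ^t*.

Definition kraus_transpose (Ks : seq 'M[C]_(dB, dA)) (Y : 'M[C]_dB) :
    'M[C]_dA :=
  \sum_(K <- Ks) K^T *m Y *m map_mx Num.conj K.

(* The Kraus representation is chosen arbitrarily; by channel_transposeE the  *)
(* result does not depend on it. The default [::] is only reached by maps     *)
(* without a Kraus representation.                                            *)
Definition channel_transpose (N : 'M[C]_dA -> 'M[C]_dB) :
    'M[C]_dB -> 'M[C]_dA :=
  kraus_transpose (xget [::] [set Ks | kraus_rep Ks N]%classic).

Definition choi (N : 'M[C]_dA -> 'M[C]_dB) : 'M[C]_(dA * dB) :=
  \sum_(i < dA) \sum_(j < dA) delta_mx i j *t N (delta_mx i j).

(* The protocol; systems are ordered A' A B' before the query and A' B B'     *)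
(* after it, both grouped to the left.                                        *)

Definition initial_state (rho : 'M[C]_dB) : 'M[C]_(dA * dA * dB) :=
  maxent dA *t rho.

Definition premeasurement_state (N : 'M[C]_dA -> 'M[C]_dB) (rho : 'M[C]_dB) :
    'M[C]_(dA * dB * dB) :=
  tensmap (tensmap (fun Y : 'M[C]_dA => Y) N) (fun Y : 'M[C]_dB => Y)
    (initial_state rho).

(* The same operator with the systems grouped as A' (B B'); mxtens_index is   *)
(* associative on the underlying naturals, so this is a mere cast.            *)
Definition regroup (X : 'M[C]_(dA * dB * dB)) : 'M[C]_(dA * (dB * dB)) :=
  castmx (esym (mulnA dA dB dB), esym (mulnA dA dB dB)) X.

Definition accept_projector : 'M[C]_(dA * (dB * dB)) := 1%:M *t maxent dB.

Definition accepted_state (N : 'M[C]_dA -> 'M[C]_dB) (rho : 'M[C]_dB) :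
    'M[C]_dA :=
  ptrace2 (accept_projector *m regroup (premeasurement_state N rho)
             *m accept_projector).

Definition success_prob (N : 'M[C]_dA -> 'M[C]_dB) (rho : 'M[C]_dB) : C :=
  \tr (accepted_state N rho).

End Channels.

Lemma tensmap_tens m n p q (F : {linear 'M[C]_m -> 'M[C]_n})
    (G : {linear 'M[C]_p -> 'M[C]_q}) A B :
  tensmap F G (A *t B) = F A *t G B.
Proof.
rewrite [A in RHS]matrix_sum_delta [B in RHS]matrix_sum_delta !linear_sum /=.
apply/matrixP => r c; case: (mxtens_indexP r) => r1 r2.
case: (mxtens_indexP c) => c1 c2; rewrite tensmxE !summxE mulr_suml.
apply: eq_bigr => i _; rewrite linear_sum !summxE mulr_suml.
apply: eq_bigr => j _; rewrite mulr_sumr summxE.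
apply: eq_bigr => k _; rewrite linear_sum !summxE mulr_sumr.
apply: eq_bigr => l _; rewrite !linearZ mxE !tensmxE !mxE.
by rewrite mulrACA.
Qed.

Lemma channel_transposeE dA dB (N : 'M[C]_dA -> 'M[C]_dB) Ks :
  kraus_rep Ks N -> channel_transpose N =1 kraus_transpose Ks.
Proof.
suff H Ls : kraus_rep Ls N -> forall Y a b, kraus_transpose Ls Y a b =
    \sum_c \sum_d Y c d * N (delta_mx a b) c d.
  move=> KsN Y; rewrite /channel_transpose; case: xgetP => [Ls _ LsN|/(_ Ks)//].
  by apply/matrixP => a b; rewrite !H.
move=> LsN Y a b; rewrite summxE.
under [RHS]eq_bigr => c _.
  under eq_bigr => d _ do rewrite LsN summxE mulr_sumr.
  rewrite exchange_big; over.
rewrite exchange_big; apply: eq_bigr => K _ /=.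
rewrite mxE exchange_big; apply: eq_bigr => d _ /=.
rewrite mxE mulr_suml; apply: eq_bigr => c _.
have -> : (K *m delta_mx a b *m K ^t*) c d = K c a * (K d b)^*.
  rewrite mxE (bigD1 b) //= big1 => [|k kb]; last first.
    rewrite mxE big1 ?mul0r // => l _.
    by rewrite mxE (negPf kb) andbF mulr0.
  rewrite addr0 mxE (bigD1 a) //= big1 => [|l la]; last first.
    by rewrite mxE (negPf la) mulr0.
  by rewrite !mxE !eqxx mulr1 addr0.
by rewrite !mxE [K c a * Y c d]mulrC mulrA.
Qed.

Lemma maxentE d (a b c e : 'I_d) :
  maxent d (mxtens_index (a, b)) (mxtens_index (c, e)) =
    d%:R^-1 * ((a == b) && (c == e))%:R.
Proof.
have inj x y : (mxtens_index x == mxtens_index y :> 'I_(d * d)) = (x == y).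
  exact/(can_eq (@mxtens_indexK d d)).
rewrite mxE summxE (bigD1 a) //= [X in _ + X]big1 => [|i ia]; last first.
  rewrite summxE big1 // => j _.
  by rewrite mxE inj xpair_eqE eq_sym (negPf ia).
rewrite addr0 summxE (bigD1 c) //= big1 => [|j jc]; last first.
  by rewrite mxE !inj !xpair_eqE [c == j]eq_sym (negPf jc) andbF.
by rewrite addr0 mxE !inj !xpair_eqE !eqxx /= [b == a]eq_sym [e == c]eq_sym.
Qed.

Lemma maxent_herm d : (maxent d) ^t* = maxent d.
Proof.
apply/matrixP => r s; case: (mxtens_indexP r) => a b.
case: (mxtens_indexP s) => c e.
by rewrite mxE mxE !maxentE rmorphM rmorph_nat /= fmorphV rmorph_nat andbC.
Qed.

Lemma maxent_idem d : maxent d *m maxent d = maxent d.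
Proof.
have [->|d_neq0] := eqVneq d 0%N; first by apply/matrixP => -[].
apply/matrixP => r s; case: (mxtens_indexP r) => a b.
case: (mxtens_indexP s) => c e; rewrite maxentE mxE.
rewrite (reindex (@mxtens_index d d)) /=; last first.
  by exists (@mxtens_unindex d d) => x _; rewrite (mxtens_indexK, mxtens_unindexK).
rewrite (eq_bigr (fun x : 'I_d * 'I_d =>
    d%:R^-1 ^+ 2 * (x.1 == x.2)%:R * ((a == b) && (c == e))%:R)).
  rewrite -mulr_suml -mulr_sumr -(pair_bigA _ (fun i j => (i == j)%:R)) /=.
  rewrite (eq_bigr (fun=> 1)) ?sumr_const ?card_ord => [|i _]; last first.
    rewrite (bigD1 i) //= big1 ?eqxx ?addr0 // => j ji.
    by rewrite eq_sym (negPf ji).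
  by rewrite expr2 -[_^-1 * _ * _]mulrA mulVf ?mulr1 ?pnatr_eq0.
move=> [x y] _ /=; rewrite !maxentE.
case: (a == b); case: (x == y); case: (c == e);
  by rewrite /= ?mulr0 ?mul0r ?mulr1 ?expr2.
Qed.

End Operators.

(* Main.v *)
Require Import Defs.
From HB Require Import structures.
From mathcomp Require Import all_boot all_order all_algebra.
From mathcomp Require Import reals complex mxtens.
Import Order.TTheory GRing.Theory Num.Theory.
Local Open Scope ring_scope.
Local Open Scope complex_scope.

(** Expanding the definitions shows that the accepted state has entries
    (d_A d_B)^-1 sum_(c,d) rho_cd N(|a><b|)_cd, and so does N^T(rho) / (d_A d_B)
    for every Kraus representation of N.  Since N^T is defined through some Kraus
    representation, one must be produced from complete positivity: the Choi
    operator is positive semidefinite, hence by the spectral theorem a sum of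
    terms v v^*, and reshaping the vectors v into matrices gives the Kraus
    operators (Choi's theorem). *)

Section Protocol.
Set Implicit Arguments.
Unset Strict Implicit.
Local Open Scope sesquilinear_scope.
Variable C : numClosedFieldType.

(** * Tensor products and the Choi operator *)

Lemma sum_mxtens_index (V : nmodType) m p (F : 'I_(m * p) -> V) :
  \sum_k F k = \sum_i \sum_j F (mxtens_index (i, j)).
Proof.
rewrite pair_bigA /= (reindex (@mxtens_index m p)) /=; last first.
  by exists (@mxtens_unindex m p) => x _; rewrite (mxtens_indexK, mxtens_unindexK).
by apply: eq_bigr => -[].
Qed.

Lemma delta_mx_tens m n p q (i : 'I_m) (j : 'I_n) (k : 'I_p) (l : 'I_q) :
  delta_mx (mxtens_index (i, k)) (mxtens_index (j, l)) =
  delta_mx i j *t delta_mx k l :> 'M[C]_(_, _).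
Proof.
apply/matrixP => r s; case: (mxtens_indexP r) => a b.
case: (mxtens_indexP s) => c e; rewrite tensmxE !mxE.
rewrite !(can_eq (@mxtens_indexK _ _)) !xpair_eqE -natrM mulnb.
by rewrite andbACA.
Qed.

(** The instance built on it lets a [tensmap] be itself a factor in [tensmap_tens], as the nested
    form of the pre-measurement state requires. *)
Lemma tensmap_is_linear m n p q (F : 'M[C]_m -> 'M[C]_n)
    (G : 'M[C]_p -> 'M[C]_q) : linear (tensmap F G).
Proof.
move=> a X Y; rewrite /tensmap scaler_sumr -big_split; apply: eq_bigr => i _ /=.
rewrite scaler_sumr -big_split; apply: eq_bigr => j _ /=.
rewrite scaler_sumr -big_split; apply: eq_bigr => k _ /=.
rewrite scaler_sumr -big_split; apply: eq_bigr => l _ /=.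
by rewrite !mxE scalerDl scalerA.
Qed.

HB.instance Definition _ m n p q (F : 'M[C]_m -> 'M[C]_n)
    (G : 'M[C]_p -> 'M[C]_q) :=
  GRing.isLinear.Build C 'M[C]_(m * p) 'M[C]_(n * q) *:%R (tensmap F G)
    (@tensmap_is_linear m n p q F G).

Lemma choiE dA dB (N : 'M[C]_dA -> 'M[C]_dB) i b j e :
  choi N (mxtens_index (i, b)) (mxtens_index (j, e)) = N (delta_mx i j) b e.
Proof.
rewrite summxE (bigD1 i) //= [X in _ + X]big1 => [|k ki]; last first.
  rewrite summxE big1 // => l _.
  by rewrite tensmxE mxE eq_sym (negPf ki) mul0r.
rewrite addr0 summxE (bigD1 j) //= big1 => [|l lj]; last first.
  by rewrite tensmxE mxE [j == l]eq_sym (negPf lj) andbF mul0r.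
by rewrite addr0 tensmxE mxE !eqxx mul1r.
Qed.

(** Each |ii><jj| splits as |i><j| (x) |i><j|. The formula serves twice: for the positivity of the
    Choi operator and for the state after the query. *)
Lemma tensmap_maxent dA dB (N : {linear 'M[C]_dA -> 'M[C]_dB}) :
  tensmap (fun Y : 'M[C]_dA => Y) N (maxent C dA) = dA%:R^-1 *: choi N.
Proof.
rewrite /maxent linearZ_LR; congr (_ *: _); rewrite linear_sum.
apply: eq_bigr => i _; rewrite linear_sum; apply: eq_bigr => j _.
rewrite delta_mx_tens; exact: (tensmap_tens (idfun : {linear _ -> _})).
Qed.

(** * Positive semidefinite matrices *)

Lemma psd_gram m n (A : 'M[C]_(m, n)) : psd (A ^t* *m A).
Proof.
move=> v; rewrite !mulmxA -mulmxA.
have -> : v ^t* *m A ^t* = (A *m v) ^t* by rewrite trmx_mul map_mxM.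
rewrite mxE; apply: sumr_ge0 => i _.
by rewrite !mxE mulrC mul_conjC_ge0.
Qed.

Lemma psdZ n a (X : 'M[C]_n) : 0 <= a -> psd X -> psd (a *: X).
Proof.
move=> a_ge0 psdX v; rewrite -scalemxAr -scalemxAl mxE.
exact: mulr_ge0 (psdX v).
Qed.

Lemma psd_choi dA dB (N : {linear 'M[C]_dA -> 'M[C]_dB}) :
  completely_positive N -> psd (choi N).
Proof.
(* In dimension 0 the scalar [dA%:R] cannot be cancelled, but the index set of the Choi operator is
   then empty. *)
have [dA0|dA_neq0] := eqVneq dA 0%N.
  move=> _ v; rewrite mxE big1 // => r _.
  by case: (mxtens_indexP r) => i j; have : (i < 0)%N by rewrite -dA0.
have nz : dA%:R != 0 :> C by rewrite pnatr_eq0.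
move=> /(_ dA (maxent C dA)); rewrite tensmap_maxent => CP.
rewrite -[choi N]scale1r -(mulfV nz) -scalerA; apply: psdZ; first exact: ler0n.
(* A hermitian idempotent [P] equals [P ^t* *m P], a Gram matrix. *)
apply: CP; rewrite -maxent_idem -{1}maxent_herm; exact: psd_gram.
Qed.

(** Polarization: over complex scalars the values on the diagonal determine a sesquilinear form. *)
Lemma quad_form_eq0 n (B : 'M[C]_n) :
  (forall v : 'cV[C]_n, (v ^t* *m B *m v) 0 0 = 0) -> B = 0.
Proof.
move=> B0; apply/matrixP => i j; rewrite mxE.
pose f (u v : 'cV[C]_n) : C := (u ^t* *m B *m v) 0 0.
have expand (u v : 'cV[C]_n) a : f (u + a *: v) (u + a *: v) =
    f u u + a * f u v + (a^* * f v u + a^* * a * f v v).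
  rewrite /f; have -> : (u + a *: v) ^t* = u ^t* + a^* *: v ^t*.
    by apply/matrixP => k l; rewrite !mxE rmorphD rmorphM.
  rewrite !mulmxDl !mulmxDr -!scalemxAl -!scalemxAr scalerA.
  have mxD (X Y : 'M[C]_1) : (X + Y) 0 0 = X 0 0 + Y 0 0 by rewrite mxE.
  have mxZ c (X : 'M[C]_1) : (c *: X) 0 0 = c * X 0 0 by rewrite mxE.
  by rewrite !mxD !mxZ.
pose x := f (delta_mx i 0) (delta_mx j 0).
pose y := f (delta_mx j 0) (delta_mx i 0).
have polar a : a^* * y + a * x = 0.
  have := expand (delta_mx i 0) (delta_mx j 0) a.
  have f0 v : f v v = 0 by exact: B0.
  by rewrite !f0 mulr0 addr0 add0r addrC.
have -> : B i j = x.
  by rewrite /x /f -colE mxE trmx_delta map_delta_mx -rowE !mxE.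
(* Taking [a = 1] gives [y = - x]; then [a = 'i] gives ['i * (x + x) = 0]. *)
have /eqP := polar 1; rewrite rmorph1 !mul1r addr_eq0 => /eqP yx.
have /eqP := polar 'i%R; rewrite conjCi yx mulrNN -mulrDr mulf_eq0.
by rewrite (negPf (neq0Ci _)) -mulr2n mulrn_eq0 /= => /eqP.
Qed.

(** At each vector the form of [X ^t*] is the conjugate of the form of [X], which is real. *)
Lemma psd_herm n (X : 'M[C]_n) : psd X -> X ^t* = X.
Proof.
move=> psdX; apply/eqP; rewrite -subr_eq0; apply/eqP/quad_form_eq0 => v.
rewrite mulmxBr mulmxBl mxE [X in _ + X]mxE.
have -> : v ^t* *m X ^t* *m v = (v ^t* *m X *m v) ^t*.
  by rewrite !trmx_mul !map_mxM /= trmxCK mulmxA.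
by rewrite mxE mxE (CrealP (ger0_real (psdX v))) subrr.
Qed.

(** With [P] unitary and [X = P ^t* D P], the witness is [P ^t*] times the square root of [D]. *)
Lemma psd_decomposition n (X : 'M[C]_n) : psd X ->
  exists V : 'M[C]_n, forall i j, X i j = \sum_k V i k * (V j k)^*.
Proof.
move=> psdX; have normX : X \is normalmx.
  by apply/normalmxP; rewrite psd_herm.
have Usp := spectral_unitarymx X.
have defX := orthomx_spectralP normX.
move: Usp defX; set P := spectralmx X; set D := spectral_diag X => Usp.
rewrite invmx_unitary // => defX.
(* An eigenvalue is the value of the form at its unit eigenvector, column [k] of [P ^t*]. *)
have D_ge0 k : 0 <= D 0 k.
  have := psdX (P ^t* *m delta_mx k 0).
  rewrite {1}defX trmx_mul map_mxM /= trmxCK !mulmxA.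
  have /unitarymxP PP := Usp.
  rewrite -[_ *m P *m P ^t*]mulmxA PP mulmx1.
  rewrite -[_ *m P *m P ^t*]mulmxA PP mulmx1.
  by rewrite -colE mxE trmx_delta map_delta_mx -rowE !mxE eqxx mulr1n.
exists (\matrix_(i, k) (sqrtC (D 0 k) * (P k i)^*)) => i j.
rewrite {1}defX mxE; apply: eq_bigr => k _.
rewrite mul_mx_diag !mxE rmorphM /= conjCK.
rewrite (@CrealP _ (sqrtC _) _) ?ger0_real ?sqrtC_ge0 //.
by rewrite mulrACA -expr2 sqrtCK mulrA [(P k i)^* * _]mulrC.
Qed.

(** * Kraus representations and the transpose map *)

Lemma kraus_rep_exists dA dB (N : {linear 'M[C]_dA -> 'M[C]_dB}) :
  completely_positive N -> exists Ks, kraus_rep Ks N.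
Proof.
move=> /psd_choi/psd_decomposition[V defV].
(* Column [k] of [V] is indexed by pairs (input [i], output [b]); reshaped, it is a Kraus
   operator. *)
pose K k : 'M[C]_(dB, dA) := \matrix_(b, i) V (mxtens_index (i, b)) k.
exists [seq K k | k : 'I_(dA * dB)] => X.
rewrite big_image /= [X in LHS]matrix_sum_delta linear_sum.
apply/matrixP => b e; rewrite !summxE.
transitivity (\sum_k \sum_i \sum_j K k b i * X i j * (K k e j)^*); last first.
  apply: eq_bigr => k _; rewrite [RHS]mxE exchange_big; apply: eq_bigr => j _.
  by rewrite [X in X * _]mxE mulr_suml ![_ j e]mxE.
rewrite exchange_big; apply: eq_bigr => i _.
rewrite linear_sum summxE exchange_big; apply: eq_bigr => j _.
rewrite linearZ_LR [LHS]mxE -(choiE N) defV mulr_sumr; apply: eq_bigr => k _.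
by rewrite !mxE mulrA [_ * V _ _]mulrC.
Qed.

(** Complete positivity provides a Kraus representation, so [channel_transpose] does not take its
    default value. *)
Lemma channel_transpose_entry dA dB (N : {linear 'M[C]_dA -> 'M[C]_dB}) Y a b :
  completely_positive N ->
  channel_transpose N Y a b = \sum_c \sum_d Y c d * N (delta_mx a b) c d.
Proof.
move=> /kraus_rep_exists[Ks KsN]; rewrite (channel_transposeE KsN) summxE.
under [RHS]eq_bigr => c _ do
  under eq_bigr => d _ do rewrite KsN summxE mulr_sumr.
under [RHS]eq_bigr do rewrite exchange_big.
rewrite exchange_big; apply: eq_bigr => K _ /=.
rewrite mxE exchange_big; apply: eq_bigr => d _ /=.
rewrite mxE mulr_suml; apply: eq_bigr => c _.
(* As |a><b| has rank one, this is a column times a row. *)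
have -> : K *m delta_mx a b *m K ^t* = col a K *m row b (K ^t*).
  by rewrite colE rowE mulmxA -[K *m delta_mx a 0 *m _]mulmxA mul_delta_mx.
by rewrite [X in _ = _ * X]mxE big_ord1 !mxE mulrCA mulrA.
Qed.

(** * The acceptance measurement *)

Lemma mul_1tens m p n (A : 'M[C]_p) (X : 'M[C]_(m * p, n)) a k s :
  ((1%:M *t A) *m X) (mxtens_index (a, k)) s =
  \sum_l A k l * X (mxtens_index (a, l)) s.
Proof.
rewrite mxE sum_mxtens_index (bigD1 a) //= [X in _ + X]big1 => [|i ia].
  by rewrite addr0; apply: eq_bigr => l _; rewrite tensmxE mxE eqxx mul1r.
by rewrite big1 // => l _; rewrite tensmxE mxE eq_sym (negPf ia) !mul0r.
Qed.

Lemma mul_tens1 m p n (A : 'M[C]_p) (X : 'M[C]_(n, m * p)) a k s :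
  (X *m (1%:M *t A)) s (mxtens_index (a, k)) =
  \sum_l X s (mxtens_index (a, l)) * A l k.
Proof.
rewrite mxE sum_mxtens_index (bigD1 a) //= [X in _ + X]big1 => [|i ia].
  by rewrite addr0; apply: eq_bigr => l _; rewrite tensmxE mxE eqxx mul1r.
by rewrite big1 // => l _; rewrite tensmxE mxE (negPf ia) mul0r mulr0.
Qed.

(** The partial trace is cyclic for operators acting on the traced factor alone. *)
Lemma ptrace2_mulC m p (A : 'M[C]_p) (X : 'M[C]_(m * p)) :
  ptrace2 ((1%:M *t A) *m X) = ptrace2 (X *m (1%:M *t A)).
Proof.
apply/matrixP => i j; rewrite !mxE.
under eq_bigr do rewrite mul_1tens.
under [RHS]eq_bigr do rewrite mul_tens1.
by rewrite exchange_big; do 2!apply: eq_bigr => ? _; rewrite mulrC.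
Qed.

(** Both groupings give the natural number [a * dB * dB + b * dB + b']. *)
Lemma regroupE dA dB (X : 'M[C]_(dA * dB * dB)) a b b' c e e' :
  regroup X (mxtens_index (a, mxtens_index (b, b')))
    (mxtens_index (c, mxtens_index (e, e'))) =
  X (mxtens_index (mxtens_index (a, b), b'))
    (mxtens_index (mxtens_index (c, e), e')).
Proof.
by rewrite castmxE; congr (X _ _); apply: val_inj;
  rewrite /= mulnDl -mulnA addnA.
Qed.

Lemma premeasurement_stateE dA dB (N : {linear 'M[C]_dA -> 'M[C]_dB}) rho :
  premeasurement_state N rho = (dA%:R^-1 *: choi N) *t rho.
Proof.
rewrite -tensmap_maxent.
exact: (tensmap_tens (tensmap idfun N) (idfun : {linear _ -> _})).
Qed.

Lemma accepted_stateE dA dB (N : {linear 'M[C]_dA -> 'M[C]_dB}) rho a b :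
  accepted_state N rho a b =
  (dA%:R * dB%:R)^-1 * \sum_c \sum_d rho c d * N (delta_mx a b) c d.
Proof.
(* The left projector is moved to the right and absorbed by idempotence. *)
rewrite /accepted_state -mulmxA ptrace2_mulC -mulmxA tensmx_mul mulmx1.
rewrite maxent_idem mxE sum_mxtens_index.
under eq_bigr => c _ do under eq_bigr => c' _ do
  rewrite mul_tens1 sum_mxtens_index.
rewrite mulr_sumr; apply: eq_bigr => c _.
(* The projector forces equal indices on [B] and [B'], in rows and in columns. Entry [c d] of [rho]
   thus meets entry [c d] of the output of [N], which is where the transpose comes from. *)
rewrite (bigD1 c) //= [X in _ + X]big1 ?addr0 => [|c' cc']; last first.
  rewrite big1 // => d _; rewrite big1 // => d' _.
  by rewrite maxentE [c == _]eq_sym (negPf cc') andbF !mulr0.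
rewrite mulr_sumr; apply: eq_bigr => d _.
rewrite (bigD1 d) //= [X in _ + X]big1 ?addr0 => [|d' dd']; last first.
  by rewrite maxentE [d == _]eq_sym (negPf dd') !mulr0.
rewrite maxentE !eqxx mulr1 regroupE premeasurement_stateE.
rewrite tensmxE mxE choiE invfM [_ * dB%:R^-1]mulrC !mulrA [_^-1 * _^-1]mulrC.
by rewrite -!mulrA [N _ _ _ * _]mulrC.
Qed.

(** Tracing out the input of the Choi operator leaves the sum of the [N] |i><i|, which is
    [N 1%:M]. *)
Lemma tr_choi dA dB (N : {linear 'M[C]_dA -> 'M[C]_dB}) (Y : 'M[C]_dB) :
  \tr (choi N *m ((1%:M : 'M[C]_dA) *t Y)) = \tr (N 1%:M *m Y).
Proof.
rewrite /mxtrace sum_mxtens_index exchange_big; apply: eq_bigr => b _ /=.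
under eq_bigr do rewrite mul_tens1.
rewrite exchange_big mxE; apply: eq_bigr => c _ /=.
rewrite mx1_sum_delta linear_sum summxE mulr_suml.
by apply: eq_bigr => i _; rewrite choiE.
Qed.

Lemma success_probE dA dB (N : {linear 'M[C]_dA -> 'M[C]_dB}) rho :
  success_prob N rho = \tr (N 1%:M *m rho^T) / (dA%:R * dB%:R).
Proof.
rewrite /success_prob /mxtrace mulrC mulr_sumr.
under eq_bigr do rewrite accepted_stateE.
rewrite -!mulr_sumr; congr (_ * _).
rewrite exchange_big; apply: eq_bigr => c _ /=.
rewrite exchange_big mxE; apply: eq_bigr => d _ /=.
rewrite mx1_sum_delta linear_sum summxE mulr_suml.
by apply: eq_bigr => i _; rewrite mxE mulrC.
Qed.

End Protocol.

Theorem mainTheorem3 (R : realType) (dA dB : nat)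
    (dA_gt0 : (0 < dA)%N) (dB_gt0 : (0 < dB)%N)
    (N : {linear 'M[R[i]]_dA -> 'M[R[i]]_dB}) (channelN : channel N)
    (rho : 'M[R[i]]_dB) (density_rho : density rho) :
  [/\ accepted_state N rho = (dA%:R * dB%:R)^-1 *: channel_transpose N rho,
      (success_prob N rho != 0 ->
       (success_prob N rho)^-1 *: accepted_state N rho =
       (\tr (channel_transpose N rho))^-1 *: channel_transpose N rho),
      success_prob N rho =
        \tr (choi N *m ((1%:M : 'M[R[i]]_dA) *t rho^T)) / (dA%:R * dB%:R)
    & forall d : nat, dA = d -> dB = d -> N 1%:M = 1%:M ->
        success_prob N rho = 1 / d%:R ^+ 2].
Proof.
have [[CP _] [_ tr_rho]] := (channelN, density_rho).
have acc : accepted_state N rho =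
    (dA%:R * dB%:R)^-1 *: channel_transpose N rho.
  apply/matrixP => a b.
  by rewrite accepted_stateE [RHS]mxE channel_transpose_entry.
split=> //.
(* The factor [(dA%:R * dB%:R)^-1] divides the nonzero probability, so it cancels on normalizing. *)
- rewrite /success_prob acc mxtraceZ mulf_eq0 negb_or => /andP[nz _].
  by rewrite scalerA invfM mulrAC mulVf // mul1r.
- by rewrite success_probE tr_choi.
- move=> d dAd dBd N1.
  by rewrite success_probE N1 mul1mx mxtrace_tr tr_rho dAd dBd expr2.
Qed.
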